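(* Every subsemigroup (with the subspace topology) of a commutative cancellative locally compact pseudocompact Hausdorff topological semigroup with open shifts has countable cellularity.
   Context: A topological semigroup is a nonempty set $S$ with an associative operation and a topology such that the operation $S\times S\to S$ is jointly continuous. It has open shifts if for every $a\in S$ and every open $U\subseteq S$ the sets $aU$ and $Ua$ are open in $S$. A space is locally compact if each point has a compact neighborhood. A (Tychonoff) space is pseudocompact if every continuous real-valued function on it is bounded. Subsemigroups are nonempty. A cellular family in a space $X$ is a nonempty pairwise disjoint family of nonempty open sets in $X$; the cellularity is $c(X)=\sup\{|\mathcal U|:\mathcal U\text{ is a cellular family in }X\}+\aleph_0$, and $X$ has countable cellularity if $c(X)=\aleph_0$. *)

(* Defs.v *)
From HB Require Import structures.
From mathcomp Require Import all_boot all_order all_algebra.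
From mathcomp Require Import all_classical all_reals all_analysis.

Set Implicit Arguments.
Unset Strict Implicit.
Unset Printing Implicit Defensive.

Import numFieldNormedType.Exports.

Local Open Scope classical_set_scope.
Local Open Scope card_scope.

HB.structure Definition PreTopologicalSemigroup :=
  {S of Topological S & Semigroup S}.

HB.mixin Record PreTopologicalSemigroup_isTopologicalSemigroup S
    & PreTopologicalSemigroup S := {
  semigroup_nonempty : [set: S] !=set0 ;
  mulg_continuous : continuous (fun xy : S * S => (xy.1 * xy.2)%g)
}.

#[short(type="topologicalSemigroupType")]
HB.structure Definition TopologicalSemigroup :=
  {S of PreTopologicalSemigroup S
      & PreTopologicalSemigroup_isTopologicalSemigroup S}.

Definition cancellative (S : semigroupType) : Prop :=
  right_injective (fun x y : S => (x * y)%g) /\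
  left_injective (fun x y : S => (x * y)%g).

Definition open_shifts (S : topologicalSemigroupType) : Prop :=
  forall (a : S) (U : set S), open U ->
    open [set (a * u)%g | u in U] /\ open [set (u * a)%g | u in U].

Definition subsemigroup (S : semigroupType) (H : set S) : Prop :=
  H !=set0 /\ forall x y, H x -> H y -> H (x * y)%g.

(* The Tychonoff axiom is not part of this predicate; it is automatic for the
   locally compact Hausdorff spaces to which the predicate is applied. *)
Definition pseudocompact (R : realType) (X : topologicalType) : Prop :=
  forall f : X -> R, continuous f -> [bounded f x | x in [set: X]].

Definition cellular_family (X : topologicalType) (U : set (set X)) : Prop :=
  [/\ U !=set0, trivIset U id & forall A, U A -> open A /\ A !=set0].

(* Cardinals are represented by sets compared with #<=. Since the sum of a
   cardinal k and aleph_0 is max(k, aleph_0), the cellularity of X is the least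
   cardinal bounding aleph_0 and the cardinalities of all cellular families. *)
Definition cellularity_bound (X : topologicalType) T (K : set T) : Prop :=
  [set: nat] #<= K /\ forall U : set (set X), cellular_family U -> U #<= K.

Definition has_cellularity (X : topologicalType) T (K : set T) : Prop :=
  cellularity_bound X K /\
  forall T' (L : set T'), cellularity_bound X L -> K #<= L.

Definition countable_cellularity (X : topologicalType) : Prop :=
  has_cellularity X [set: nat].

Lemma countable_cellularityP (X : topologicalType) :
  countable_cellularity X <->
  forall U : set (set X), cellular_family U -> countable U.
Proof.
split=> [[[_ h] _]//|h]; split; last by move=> T' L [].
by split=> //; exact: card_lexx.
Qed.

(* Main.v *)
Require Import Defs.
From HB Require Import structures.
From mathcomp Require Import all_boot all_order all_algebra.
From mathcomp Require Import all_classical all_reals all_analysis.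

(** Call a set A syndetic in the subsemigroup H with bound n if n shifts by
    elements of H suffice so that every point of H is sent into A by at least
    one of them.  The theorem follows from two facts.

    A counting argument: in a commutative semigroup, pairwise disjoint sets
    that are syndetic with bound n are at most n in number
    ([leq_syndetic_disjoint]).  It replaces the invariant measure one would use
    on a compact group, where such a set has measure at least 1/n.  Hence, if
    every nonempty open subset of H is syndetic, a cellular family is the union
    over n of finite families, so it is countable.

    Every nonempty relatively open subset of H is syndetic ([open_syndetic]).
    Think of S as an open subset of its group of quotients.  If Q contains
    W a W for an open W around a and the translates x k Q were pairwise
    disjoint, each point of S would have a neighbourhood meeting at most one of
    the sets x k W, and such a sequence of sets carries an unbounded continuous
    function
    ([pseudocompact_discrete_sequence], [recurrent_translates]).  Applied to a
    sequence chosen greedily in H, this gives a finite subset F of H such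
    that every x in H has x/f close to 1 for some f in F.  Applied to the
    sequence h, f h, f (f h), ... it gives some g in H with f g / h close to 1.
    Then g x / h is close to 1 as well, with g in a finite subset of H.

    In the group of quotients, close to 1 means here: of the form t'/t with t
    and t' in a small open set.  To conclude that g x is close to h, division
    must be continuous.  This is the content of [divg_continuous], the analogue
    of the theorem that a locally compact paratopological group is a
    topological group; its proof studies a cluster point of an infinite
    product. *)

Set Implicit Arguments.
Unset Strict Implicit.
Unset Printing Implicit Defensive.

Import Order.TTheory GRing.Theory Num.Theory.
Import numFieldNormedType.Exports.

Local Open Scope classical_set_scope.

(** * Disjoint syndetic sets *)

Definition syndetic (S : semigroupType) n (H A : set S) : Prop :=
  exists g : 'I_n -> S, (forall j, H (g j)) /\
    forall x, H x -> exists j, A (g j * x)%g.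

Section Counting.
Local Open Scope group_scope.
Variable S : semigroupType.
Hypothesis mulC : commutative (@monoid.mul S).

#[local] HB.instance Definition _ :=
  SemiGroup.isComLaw.Build S (@monoid.mul S) (@mulgA S) mulC.

(** Fix i and let g i be the n shifts witnessing that A i is syndetic.  For a
    choice t of one shift per index, let p t be their product.  Changing only
    t i, some value J sends p t into A i, and the pair (changed t, old t i)
    determines t; as the A i are disjoint, the changed t also determines i
    through p.  So the pairs (i, t) inject into the pairs (t, j), which is
    m * n ^ m <= n ^ m * n. *)
Lemma leq_syndetic_disjoint (H : set S) (m n : nat) (A : 'I_m -> set S) :
  subsemigroup H -> (forall i, syndetic n H (A i)) ->
  (forall i k x, H x -> A i x -> A k x -> i = k) -> (m <= n)%N.
Proof.
move=> [[h0 Hh0] HM] /choice[g gP] Adisj.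
case: m => // m in A g gP Adisj *.
have n_gt0 : (0 < n)%N.
  by have [j _] := (gP ord0).2 _ Hh0; exact: leq_ltn_trans (ltn_ord j).
(* The extra factor h0 replaces the missing neutral element. *)
pose p (t : {ffun 'I_m.+1 -> 'I_n}) := \big[@monoid.mul S/h0]_i g i (t i).
pose upd (t : {ffun 'I_m.+1 -> 'I_n}) i j : {ffun 'I_m.+1 -> 'I_n} :=
  [ffun k => if k == i then j else t k].
have Hp t : H (p t) by apply: big_ind => // i _; exact: (gP i).1.
have /choice[J JP] (it : 'I_m.+1 * {ffun 'I_m.+1 -> 'I_n}) :
    exists j, A it.1 (p (upd it.2 it.1 j)).
  case: it => i t /=.
  pose r := \big[@monoid.mul S/h0]_(k | true && (k != i)) g k (t k).
  have Hr : H r by apply: big_ind => // k _; exact: (gP k).1.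
  have [j Aj] := (gP i).2 _ Hr; exists j.
  rewrite /p (bigD1 i) //= ffunE eqxx.
  rewrite (eq_bigr (fun k => g k (t k))) // => k /negPf ki.
  by rewrite ffunE ki.
pose F it := (upd it.2 it.1 (J it), it.2 it.1).
have /leq_card : injective F.
  move=> [i t] [k s] [eu].
  have ik : i = k.
    apply: (Adisj _ _ (p (upd t i (J (i, t))))) => //.
      exact: (JP (i, t)).
    by rewrite eu; exact: (JP (k, s)).
  rewrite -{}ik /= in eu * => eti; congr pair; apply/ffunP => l.
  have [->//|/negPf li] := eqVneq l i.
  by move/ffunP: eu => /(_ l); rewrite !ffunE li.
rewrite !card_prod card_ffun !card_ord mulnC leq_pmul2l //.
by rewrite expn_gt0 n_gt0.
Qed.

End Counting.

(** * Pseudocompactness *)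

(** If every point had a neighbourhood meeting at most one U k, bumps of height
    k supported in U k would add up to an unbounded continuous function. *)
Lemma pseudocompact_discrete_sequence (R : realType) (X : topologicalType)
    (U : nat -> set X) :
  @completely_regular_space X -> pseudocompact R X ->
  (forall k, open (U k)) -> (forall k, U k !=set0) ->
  exists s : X, forall N, nbhs s N ->
    exists k l, [/\ k != l, N `&` U k !=set0 & N `&` U l !=set0].
Proof.
move=> creg pcpt oU /choice[p Up]; apply: contrapT => nacc.
have /choice[N NP] (s : X) : exists N, nbhs s N /\
    forall k l, N `&` U k !=set0 -> N `&` U l !=set0 -> k = l.
  apply: contrapT => nN; apply: nacc; exists s => N sN.
  apply: contrapT => nkl; apply: nN; exists N; split => // k l Uk Ul.
  by apply: contrapT => /eqP kl; apply: nkl; exists k, l.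
have /choice[phi phiP] (k : nat) : exists phi : X -> R,
    [/\ continuous phi, phi (p k) = 0%R & forall y, ~ U k y -> phi y = 1%R].
  have := creg (p k) (~` U k) (open_closedC (oU k)).
  move=> /(_ (fun h => h (Up k)))/(@uniform_separatorP _ R)[f [fc _ f0 f1]].
  exists f; split => //; first by apply: f0; exists (p k).
  by move=> y Uy; apply: f1; exists y.
pose idx s := xget 0%N [set k | N s `&` U k !=set0].
(* The bump on U k has height k at p k; near s only the bump of index idx s can
   be nonzero. *)
pose psi k (y : X) : R := (k%:R * (1 - phi k y))%R.
pose f y := psi (idx y) y.
have idxE s k : N s `&` U k !=set0 -> idx s = k.
  by move=> sk; rewrite /idx; case: xgetP => [j _ sj|/(_ k)//]; exact: (NP s).2.
have psi0 k y : ~ U k y -> psi k y = 0%R.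
  by move=> Uy; rewrite /psi; have [_ _ ->//] := phiP k; rewrite subrr mulr0.
have Nself s : N s s by exact: nbhs_singleton (NP s).1.
have fE s y : N s y -> f y = psi (idx s) y.
  move=> sy; have [[k Uky]|nU] := pselect (exists k, U k y).
    by rewrite /f (idxE y k) ?(idxE s k) //; exists y.
  by rewrite /f !psi0 // => Uy; apply: nU; eexists; exact: Uy.
have fc : continuous f.
  move=> s; have [cphi _ _] := phiP (idx s).
  have psic : psi (idx s) @ s --> psi (idx s) s.
    apply: cvgM; first exact: cvg_cst.
    by apply: cvgB; [exact: cvg_cst | exact: cphi].
  apply: cvg_trans psic; apply: near_eq_cvg.
  by apply: filterS (NP s).1 => y /fE.
have PF := globally_properfilter (I : [set: X] (p 0%N)).
have [M /= fM] := (@ex_bound _ _ _ f _ PF).1 (pcpt f fc).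
pose k := (Num.truncn `|M|).+1.
have := fM (p k) I; rewrite /f (idxE _ k); last by exists (p k).
have [_ phi0 _] := phiP k.
rewrite /psi phi0 subr0 mulr1 normr_nat => kM.
by have := truncnS_gt `|M|; rewrite ltNge (le_trans kM (ler_norm M)).
Qed.

(** * Commutative cancellative semigroups with open shifts *)

Section OpenShifts.
Local Open Scope group_scope.
Variables (R : realType) (S : topologicalSemigroupType).
Hypothesis mulC : commutative (@monoid.mul S).
Hypothesis S_canc : cancellative S.
Hypothesis S_shifts : open_shifts S.

Let mulAC (x y z : S) : x * y * z = x * z * y.
Proof. by rewrite -mulgA [y * z]mulC mulgA. Qed.

Let mulACA (x y z t : S) : x * y * (z * t) = x * z * (y * t).
Proof. by rewrite mulgA [x * y * z]mulAC -mulgA. Qed.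

Let mulI (x : S) : injective (monoid.mul x) := S_canc.1 x.
Let mulIr (x y z : S) : y * x = z * x -> y = z.
Proof. exact: S_canc.2. Qed.

Lemma open_mulg_split (a b : S) (V : set S) : open V -> V (a * b) ->
  exists A B : set S, [/\ open A, open B, A a, B b &
    forall x y, A x -> B y -> V (x * y)].
Proof.
move=> oV Vab.
have : nbhs (a, b) [set xy : S * S | V (xy.1 * xy.2)].
  by apply: (@mulg_continuous S (a, b)); exact: open_nbhs_nbhs.
case=> -[A B] /= [nA nB] AB; exists A°, B°.
split=> [||||x y Ax By]; [exact: open_interior|exact: open_interior|
  exact: nA|exact: nB|].
by apply: (AB (x, y)); split; exact: interior_subset.
Qed.

Lemma mulgr_continuous (b : S) : continuous (fun x : S => x * b).
Proof.
move=> a V; rewrite nbhsE => -[W [oW Wab] WV].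
have [A [B [oA _ Aa Bb AB]]] := open_mulg_split oW Wab.
apply: (@filterS _ (nbhs a) _ A) => [x Ax|]; first exact/WV/AB.
exact: open_nbhs_nbhs.
Qed.

Lemma mulgl_continuous (b : S) : continuous (fun x : S => b * x).
Proof.
rewrite (_ : (fun x => _) = (fun x => x * b)); first exact: mulgr_continuous.
by apply/funext => x; rewrite mulC.
Qed.

(** The shape a * a * a makes room for an open W around a with W a W inside Q.
    If the translates x k W accumulate at s, two of them meet the neighbourhood
    of s formed by the y with y a in s W, that is, s W / a.  Clearing the
    denominator turns this into a common point of two translates of W a W. *)
Lemma recurrent_translates (x : nat -> S) (a : S) (Q : set S) :
  @completely_regular_space S -> pseudocompact R S -> open Q -> Q (a * a * a) ->
  exists k l q q', [/\ (k < l)%N, Q q, Q q' & x k * q = x l * q'].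
Proof.
move=> creg pcpt oQ Qa.
have [W [oW Wa WQ]] : exists W : set S, [/\ open W, W a &
    forall w w', W w -> W w' -> Q (w * a * w')].
  have [A [B [oA oB Aaa Ba AB]]] := open_mulg_split oQ Qa.
  exists ((fun w => w * a) @^-1` A `&` B); split=> [|//|w w' [Aw _] [_ Bw']].
    apply: openI => //; apply: open_comp => // y _; exact: mulgr_continuous.
  exact: AB.
have [||s sP] := pseudocompact_discrete_sequence
    (U := fun k => [set x k * w | w in W]) creg pcpt.
- by move=> k; exact: (S_shifts _ _).1.
- by move=> k; exists (x k * a), a.
have [] := sP ((fun y => y * a) @^-1` [set s * w | w in W]).
  apply: mulgr_continuous; apply: open_nbhs_nbhs; split; last by exists a.
  exact: (S_shifts _ _).1.
move=> k [l [kl [y [/= [w1 Ww1 e1] [w2 Ww2 y2]]]]].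
move=> [z [/= [v1 Wv1 d1] [v2 Wv2 z2]]].
have e : x k * (w2 * a * v1) = x l * (v2 * a * w1).
  by rewrite !mulgA y2 z2 -e1 -d1 -!mulgA [w1 * _]mulC.
have Qk := WQ _ _ Ww2 Wv1; have Ql := WQ _ _ Wv2 Ww1.
case: (ltngtP k l) kl => // [kl|lk] _.
  by exists k, l, (w2 * a * v1), (v2 * a * w1).
by exists l, k, (v2 * a * w1), (w2 * a * v1).
Qed.

Section LocallyCompact.
Hypothesis S_lcpt : locally_compact [set: S].
Hypothesis S_T2 : hausdorff_space S.

Lemma open_precompact_nbhs (a : S) (A : set S) : open A -> A a ->
  exists O : set S, [/\ open O, O a, compact (closure O) & closure O `<=` A].
Proof.
move=> oA Aa; have [K] := @S_lcpt a I; rewrite withinET => nK [cK clK].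
have reg := @completely_regular_regular R S
  (@locally_compact_completely_regular S R S_lcpt S_T2).
have [B nB clBA] := reg a _ (open_nbhs_nbhs (conj oA Aa)).
exists (B `&` K)°; split=> [||| y].
- exact: open_interior.
- exact: filterI.
- apply: (subclosed_compact _ cK); first exact: closed_closure.
  rewrite [X in _ `<=` X](closure_id _).1 //.
  by apply: closureS => z /interior_subset[].
- move=> h; apply: clBA; move: y h; apply: closureS.
  by move=> z /interior_subset[].
Qed.

(** In the group of quotients: h c / w is in V for w close to c.  Otherwise
    there are shrinking neighbourhoods O n of c and bad elements w n in O n.
    The O n are chosen so that, with x n standing for w n / c, all products
    c x (n+1) ... x (n+k) =: u n k exist in S and lie in O n.  The partial
    products u 0 m stay in a compact set and so have a cluster point z.  The
    tails being small, z is u 0 n times an element of the closure of O n, for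
    every n; and u 0 n is close to z for some n.  Hence the inverse of
    x (n+1), a ratio of such small quantities, is close to 1, so w (n+1) is not
    bad. *)
Lemma divg_continuous (h c : S) (V : set S) : open V -> V h ->
  exists W : set S, [/\ open W, W c &
    forall w, W w -> exists2 v, V v & v * w = h * c].
Proof.
move=> oV Vh; apply: contrapT => noW.
have bad W : open W -> W c ->
    exists2 w, W w & forall v, V v -> v * w <> h * c.
  move=> oW Wc; apply: contrapT => nw; apply: noW; exists W; split => // w Ww.
  apply: contrapT => nv; apply: nw; exists w => // v Vv vw.
  by apply: nv; exists v.
(* A and B make h x y / (c c) lie in V; this is what bounds the final ratio. *)
have [A [B [oA oB Ac Bc ABV]]] : exists A B : set S,
    [/\ open A, open B, A c, B c &
    forall x y, A x -> B y -> exists2 v, V v & h * (x * y) = v * (c * c)].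
  have oVcc : open [set v * (c * c) | v in V] by exact: (S_shifts _ _).2.
  have oP : open ((fun x => h * x) @^-1` [set v * (c * c) | v in V]).
    by apply: open_comp => // x _; exact: mulgl_continuous.
  have Pcc : ((fun x => h * x) @^-1` [set v * (c * c) | v in V]) (c * c).
    by exists h.
  have [A [B [oA oB Ac Bc AB]]] := open_mulg_split oP Pcc.
  by exists A, B; split => // x y Ax By; have [v] := AB _ _ Ax By; exists v.
have [ O0 [oO0 O0c cO0 clO0]] : exists O : set S,
    [/\ open O, O c, compact (closure O) & closure O `<=` A `&` B].
  by apply: open_precompact_nbhs => //; exact: openI.
have [next nextP] : {next : set S -> set S & forall O, open O /\ O c ->
    [/\ open (next O), next O c &
     forall x y, next O x -> next O y -> exists2 t, O t & t * c = x * y]}.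
  apply: (@choice _ _ (fun O O' => open O /\ O c -> [/\ open O', O' c &
     forall x y, O' x -> O' y -> exists2 t, O t & t * c = x * y])) => O.
  have [[oO Oc]|nO] := pselect (open O /\ O c); last by exists O.
  have oOc : open [set t * c | t in O] by exact: (S_shifts _ _).2.
  have Occ : [set t * c | t in O] (c * c) by exists c.
  have [C [D [oC oD Cc Dc CD]]] := open_mulg_split oOc Occ.
  exists (C `&` D) => _; split=> [||x y [Cx _] [_ Dy]]; [exact: openI|by []|].
  by have [t] := CD _ _ Cx Dy; exists t.
pose O n := iter n next O0.
have OP n : open (O n) /\ O n c.
  by elim: n => // n IH; have [] := nextP _ IH.
have OM n x y : O n.+1 x -> O n.+1 y -> exists2 t, O n t & t * c = x * y.
  by have [_ _] := nextP _ (OP n); exact.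
have OS n : O n.+1 `<=` O n.
  move=> x Ox; have [t Ot] := OM n x c Ox (OP n.+1).2.
  by move/mulIr => <-.
have O_O0 n : O n `<=` O0 by elim: n => // n IH x /OS /IH.
have /choice[w wP] (n : nat) :
    exists w, O n w /\ forall v, V v -> v * w <> h * c.
  by have [w] := bad _ (OP n).1 (OP n).2; exists w.
(* The O n are such that div is applied only to multiples of c. *)
pose div s := xget c [set t | t * c = s].
pose fix u n k := if k is k'.+1 then div (w n.+1 * u n.+1 k') else c.
have uP k : forall n, O n (u n k) /\ (u n k.+1 * c = w n.+1 * u n.+1 k).
  have step n k' : O n.+1 (u n.+1 k') ->
      O n (u n k'.+1) /\ u n k'.+1 * c = w n.+1 * u n.+1 k'.
    move=> Ou; have [t Ot tc] := OM _ _ _ (wP n.+1).1 Ou.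
    rewrite /= /div; case: xgetP => [s _ /= sc|/(_ t)/(_ tc)//].
    by split => //; rewrite (mulIr (etrans sc (esym tc))).
  elim: k => [|k IH] n.
    by split; [exact: (OP n).2 | exact: (step n 0%N (OP n.+1).2).2].
  by split; [exact: (step n k (IH n.+1).1).1 |
             exact: (step n k.+1 (step n.+1 k (IH n.+2).1).1).2].
have uM j k : forall n, u n (j + k)%N * c = u n j * u (n + j)%N k.
  elim: j => [|j IH] n; first by rewrite /= add0n addn0 mulC.
  apply: (@mulIr c).
  rewrite addSn (uP (j + k)%N n).2 -mulgA IH mulgA -(uP j n).2 addSnnS.
  by rewrite -!mulgA [c * _]mulC.
have [z [Oz zcl]] := cO0 (u 0%N @ \oo) _ (filterE _ (fun k =>
   subset_closure ((uP k 0%N).1))).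
have zE n : exists2 t, closure (O n) t & z * c = u 0%N n * t.
  pose C := [set u 0%N n * t | t in closure (O n)].
  have clC : closed C.
    apply: compact_closed => //; apply: continuous_compact.
      by apply: continuous_subspaceT; exact: mulgl_continuous.
    apply: (subclosed_compact _ cO0); first exact: closed_closure.
    exact/closureS/O_O0.
  apply: contrapT => nt.
  have zC : (~` C) (z * c) by move=> [t Ct tz]; apply: nt; exists t.
  have := zcl [set u 0%N m | m in [set m | n <= m]%N]
    [set y | (~` C) (y * c)].
  case.
  - by exists n => // m /= nm; exists m.
  - apply: mulgr_continuous; apply: open_nbhs_nbhs; split => //.
    exact: closed_openC.
  move=> _ [[m /= nm <-]]; apply; exists (u n (m - n)%N).
    exact/subset_closure/(uP _ n).1.
  by rewrite -[in RHS](subnKC nm) uM.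
have [n [ o Oo yn]] : exists n, exists2 o, O0 o & u 0%N n * c = z * o.
  have oz : open [set z * t | t in O0] by exact: (S_shifts _ _).1.
  have := zcl (range (u 0%N)) [set y | [set z * t | t in O0] (y * c)].
  case.
  - by exists 0%N => // m _; exists m.
  - apply: mulgr_continuous; apply: open_nbhs_nbhs; split => //.
    by exists c.
  by move=> _ [[n _ <-] [ o Oo zo]]; exists n, o.
(* With y n = u 0 n, the equations y n c = z o, z c = y (n+1) t,
   y (n+1) c = y n w (n+1) and h t o = v c c give v w (n+1) = h c after
   multiplication by y n t. *)
have [t Ot zt] := zE n.+1.
have [] := clO0 t (closureS (@O_O0 n.+1) Ot) => At _.
have [_ Bo] := clO0 o (subset_closure Oo).
have [v Vv htov] := ABV _ _ At Bo.
have u1 : u 0%N n.+1 * c = u 0%N n * w n.+1.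
  rewrite -[in LHS]addn1 uM add0n; congr (_ * _); apply: (@mulIr c).
  exact: (uP 0%N n).2.
apply: ((wP n.+1).2 v Vv).
apply: (@mulIr (u 0%N n * t)).
have -> : v * w n.+1 * (u 0%N n * t) = v * ((u 0%N n * w n.+1) * t).
  by rewrite -mulgA; congr (_ * _); rewrite mulgA [w n.+1 * _]mulC.
have -> : h * c * (u 0%N n * t) = h * t * (u 0%N n * c).
  by rewrite [_ * t]mulC mulACA [c * _]mulC.
rewrite -u1 yn.
have -> : v * (u 0%N n.+1 * c * t) = v * c * (u 0%N n.+1 * t).
  by rewrite [u 0%N n.+1 * c]mulC -[c * _ * t]mulgA [LHS]mulgA.
rewrite -zt [z * c]mulC mulgA -[v * c * c]mulgA -htov.
by rewrite [z * o]mulC !mulgA.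
Qed.

(** [divg_continuous] bounds h c / t; here both terms of the ratio t' / t vary.
    The quotient z = h c / t is near h, so y c = z t' lies in V c. *)
Lemma quotient_near (h c : S) (V : set S) : open V -> V h ->
  exists T : set S, [/\ open T, T c &
    forall y t t', T t -> T t' -> y * t = h * t' -> V y].
Proof.
move=> oV Vh.
have oVc : open [set v * c | v in V] by exact: (S_shifts _ _).2.
have Vchc : [set v * c | v in V] (h * c) by exists h.
have [A [B [oA oB Ah Bc AB]]] := open_mulg_split oVc Vchc.
have [W [oW Wc WA]] := divg_continuous c oA Ah.
exists (W `&` B); split=> [||y t t' [Wt _] [_ Bt'] yt]; [exact: openI|by []|].
have [z Az zt] := WA _ Wt.
have [v Vv vc] := AB _ _ Az Bt'.
suff -> : y = v by [].
apply: (@mulIr c); rewrite vc; apply: (@mulIr t).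
rewrite -mulgA [c * t]mulC mulgA yt -mulgA [t' * c]mulC mulgA -zt.
by rewrite -!mulgA [t * _]mulC.
Qed.

(** In the group of quotients, the element g associated with f satisfies
    f g / h = q / q', and x / f = p' / p for some f in F; multiplying,
    g x / h = (p' q) / (p q'), so g x is in V by [quotient_near]. *)
Lemma open_syndetic (H V : set S) (h : S) : pseudocompact R S ->
  subsemigroup H -> H h -> open V -> V h -> exists n, syndetic n H V.
Proof.
move=> pcpt [_ HM] Hh oV Vh.
have creg := @locally_compact_completely_regular S R S_lcpt S_T2.
pose a := h * h * h.
have [T [oT Ta TV]] := quotient_near (a * a) oV Vh.
have [A [B [oA oB Aa Ba AB]]] := open_mulg_split oT Ta.
pose Q := A `&` B.
have oQ : open Q by exact: openI.
have Qa : Q (h * h * h) by [].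
have rec x := recurrent_translates x creg pcpt oQ Qa.
have QQ q q' : Q q -> Q q' -> T (q * q') by move=> [Aq _] [_ Bq']; exact: AB.
have /choice[g gP] (f : S) : exists g, H f ->
    [/\ H g & exists q q', [/\ Q q, Q q' & f * g * q' = h * q]].
  have [Hf|nHf] := pselect (H f); last by exists f.
  (* A recurrence in the orbit of h under f is, after cancellation, a return of
     some f g to h. *)
  pose x k := iter k (monoid.mul f) h.
  have xM k y z : iter k (monoid.mul f) y * z = iter k (monoid.mul f) (y * z).
    by elim: k => //= k IH; rewrite -mulgA IH.
  have xI k : injective (iter k (monoid.mul f)).
    by elim: k => // k IH y z /mulI/IH.
  have [k [l [q [q' [kl Qq Qq' e]]]]] := rec x.
  exists (x (l - k).-1) => _; split.
    by elim: (l - k).-1 => //= i IH; exact: HM.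
  exists q, q'; split => //.
  have -> : f * x (l - k).-1 = x (l - k)%N.
    by rewrite -[in RHS](prednK (n := l - k)%N) ?subn_gt0.
  move: e; rewrite -[in x l](subnKC (ltnW kl)) /x iterD !xM.
  by move/xI.
(* Otherwise a sequence in H with pairwise disjoint translates of Q can be built
   greedily. *)
have [F [FH FP]] : exists F : seq S, (forall f, f \in F -> H f) /\
    forall x, H x -> exists2 f, f \in F &
      exists q q', [/\ Q q, Q q' & x * q = f * q'].
  apply: contrapT => noF.
  have /choice[nxt nxtP] (F : seq S) : exists x, (forall f, f \in F -> H f) ->
      H x /\ forall f q q', f \in F -> Q q -> Q q' -> x * q <> f * q'.
    have [FH|nFH] := pselect (forall f, f \in F -> H f); last by exists h.
    apply: contrapT => nx; apply: noF; exists F; split => // x Hx.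
    apply: contrapT => nf; apply: nx; exists x => _.
    split => // f q q' Ff Qq Qq' e.
    by apply: nf; exists f => //; exists q, q'.
  pose Fs n := iter n (fun F => nxt F :: F) [::].
  have FsH n : forall f, f \in Fs n -> H f.
    elim: n => // n IH f; rewrite inE => /predU1P[->|]; last exact: IH.
    exact: (nxtP _ IH).1.
  have [k [l [q [q' [kl Qq Qq' e]]]]] := rec (fun n => nxt (Fs n)).
  apply: ((nxtP _ (FsH l)).2 (nxt (Fs k)) q' q) => //.
  elim: l kl {e} => // l IH; rewrite ltnS leq_eqVlt => /predU1P[<-|/IH kl].
    exact: mem_head.
  by rewrite inE kl orbT.
exists (size F), (fun j => g (nth h F j)); split=> [j|x Hx].
  by have [] := gP _ (FH _ (mem_nth h (ltn_ord j))).
have [f Ff [p [p' [Qp Qp' xp]]]] := FP _ Hx.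
have fF : (index f F < size F)%N by rewrite index_mem.
exists (Ordinal fF) => /=; rewrite nth_index //.
have [_ [q [q' [Qq Qq' fg]]]] := gP _ (FH _ Ff).
apply: (TV _ (p * q') (q * p')); [exact: QQ|exact: QQ|].
rewrite !mulgA -[_ * x * p]mulgA xp mulgA -fg.
by rewrite [g f * f]mulC [LHS]mulAC.
Qed.

End LocallyCompact.
End OpenShifts.

(** * Countable cellularity *)

Lemma countable_bigcup_bounded (T : pointedType) (U : set T)
    (U_ : nat -> set T) :
  U `<=` \bigcup_n U_ n ->
  (forall n m (A : 'I_m -> T), injective A -> (forall i, U_ n (A i)) ->
    (m <= n)%N) -> countable U.
Proof.
move=> UU_ U_n; apply: (sub_countable (subset_card_le UU_)).
apply: bigcup_countable => // n _; apply: finite_set_countable.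
apply: contrapT => /infiniteP/pcard_leP[f].
suff: (n < n)%N by rewrite ltnn.
apply: (U_n n n.+1 (fun i => f i)) => [i j fij|i]; last exact: funS.
by apply: val_inj; apply: (inj (f := f)) fij; rewrite inE.
Qed.

Theorem corollary4p3 (R : realType) (S : topologicalSemigroupType)
    (mulS_comm : commutative (fun x y : S => (x * y)%g))
    (S_canc : cancellative S)
    (S_lcpt : locally_compact [set: S])
    (S_pcpt : pseudocompact R S)
    (S_T2 : hausdorff_space S)
    (S_shifts : open_shifts S)
    (H : set S) (H_sub : subsemigroup H) :
  countable_cellularity (set_type H).
Proof.
apply/countable_cellularityP => U [_ Udisj UP].
pose synd n (A : set (set_type H)) := syndetic n H [set val y | y in A].
apply: (@countable_bigcup_bounded (set (set_type H)) _
  (fun n => U `&` synd n)) => [A UA|n m A Ainj AU].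
  have [[V oV VA] [h Ah]] := UP _ UA.
  have Vh : V (val h) by rewrite -VA in Ah.
  have [n [g [gH gP]]] := open_syndetic mulS_comm S_canc S_shifts S_lcpt S_T2
    S_pcpt H_sub (set_valP h) oV Vh.
  exists n => //; split => //; exists g; split => // x Hx.
  have [j Vj] := gP _ Hx; exists j.
  have Hgx : H (g j * x)%g by exact: H_sub.2.
  by exists (SigSub (mem_set Hgx)) => //; rewrite -VA.
apply: (leq_syndetic_disjoint (A := fun i => [set val y | y in A i])
  mulS_comm H_sub (fun i => (AU i).2)).
move=> i k x _ /= [y Ay yx] [z Az zx]; apply: Ainj.
apply: Udisj; [exact: (AU i).1|exact: (AU k).1|].
by exists y; split => //; rewrite (val_inj (etrans yx (esym zx))).
Qed.
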